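(* Let $m\ge2$ and let $\mathcal{H}\in\mathcal{TC}_1$ have $k$ edges. Then: (i) $\lambda_1(\mathcal{H})\le\lambda_1(T_1C(k-5,0,0,0))$, and equality holds only when $\mathcal{H}=T_1C(k-5,0,0,0)$. (ii) $\lambda_1(T_1C(k-5,0,0,0))<\dfrac{m+1+\sqrt{(m+1)^2+4(k-3)(m-1)}}{2m-2}$.
   Context: A hypergraph has a finite vertex set and an edge set of non-empty subsets of the vertex set; it is $m$-uniform if all edges have cardinality $m$, and linear if two distinct edges share at most one vertex. The adjacency matrix of a linear $m$-uniform hypergraph has $(i,j)$ entry $\frac{1}{m-1}$ if $i\ne j$ lie in a common edge, and $0$ otherwise; $\lambda_1$ denotes the spectral radius of this matrix. The $m$-th power hypergraph of a graph $G(V,E)$ is the $m$-uniform hypergraph obtained by adding to each edge $e\in E$ $m-2$ new vertices $v_{e,1},\dots,v_{e,m-2}$ (distinct for distinct edges). $\mathcal{P}(\mathcal{H})$ denotes the set of $m$-th power hypergraphs of graphs. A loose cycle of length $l\ge3$, $v_1e_1v_2e_2\dots v_le_lv_1$, is the $m$-uniform hypergraph with edges $e_1,\dots,e_l$ in which $e_{i-1}\cap e_i=\{v_i\}$ (indices mod $l$, the $v_i$ distinct) and non-consecutive edges are disjoint. A linear hypergraph is $3$-cyclic (tricyclic) if it contains exactly three loose cycles. A connected $m$-uniform $3$-cyclic linear hypergraph with $n$ vertices and $k$ edges is of Type I if $n=k(m-1)-1$. $\mathcal{TC}_1$ is the collection of (connected) $3$-cyclic Type I linear hypergraphs in $\mathcal{P}(\mathcal{H})$.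 Attaching a pendant edge at a vertex $v$ means adding a new edge consisting of $v$ and $m-1$ new vertices. $T_1C(l_1,l_2,l_3,l_4)\in\mathcal{TC}_1$ is the hypergraph consisting of the five edges $e_1,\dots,e_5$ forming the three loose cycles $v_1e_1v_2e_2v_3e_3v_1$, $v_1e_3v_3e_4v_4e_5v_1$ and $v_1e_1v_2e_2v_3e_4v_4e_5v_1$, together with $l_1,l_2,l_3,l_4$ pendant edges attached at $v_1,v_2,v_3,v_4$, respectively. Equality of hypergraphs means isomorphism. *)

(* Defs.v *)
From mathcomp Require Import all_boot all_order all_algebra.
From mathcomp Require Import boolp.

Set Implicit Arguments.
Unset Strict Implicit.
Unset Printing Implicit Defensive.

Import Order.TTheory GRing.Theory Num.Theory.

Local Open Scope nat_scope.

Record hypergraph (V : finType) := Hypergraph {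
  hedges :> {set {set V}};
  hedges_neq0 : set0 \notin hedges
}.

Definition uniform (m : nat) (V : finType) (H : hypergraph V) : Prop :=
  forall e, e \in hedges H -> #|e| = m.

Definition linear_hypergraph (V : finType) (H : hypergraph V) : Prop :=
  forall e f, e \in hedges H -> f \in hedges H -> e != f -> #|e :&: f| <= 1.

Definition in_common_edge (V : finType) (H : hypergraph V) : rel V :=
  fun u v => [exists e in hedges H, (u \in e) && (v \in e)].

Definition connected_hypergraph (V : finType) (H : hypergraph V) : Prop :=
  forall u v, connect (in_common_edge H) u v.

Definition hyp_iso (V W : finType) (H : hypergraph V) (K : hypergraph W) : Prop :=
  exists f : V -> W,
    bijective f /\ [set f @: (e : {set V}) | e in hedges H] = hedges K.

(* Indices are cyclic: [ord_pred i] is [i - 1] mod [l] and [ordS i] is [i + 1]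
   mod [l].  A loose cycle is identified with its set of edges, so the choice
   of starting point and of direction does not matter. *)
Definition loose_cycle (V : finType) (C : {set {set V}}) : Prop :=
  exists (l : nat) (v : 'I_l -> V) (e : 'I_l -> {set V}),
    [/\ 3 <= l, injective v /\ injective e, C = [set e i | i : 'I_l],
        forall i, e (ord_pred i) :&: e i = [set v i]
      & forall i j, i != j -> i != ordS j -> j != ordS i -> e i :&: e j = set0].

Definition num_loose_cycles (V : finType) (H : hypergraph V) : nat :=
  #|[set C in powerset (hedges H) | `[< loose_cycle C >]]|.

Section Power.
Variables (V : finType) (G : hypergraph V) (m : nat).

Definition edge_of : finType := {e : {set V} | e \in hedges G}.

(* [inr (e, j)] is the new vertex [v_{e,j}]. *)
Definition power_vertex : finType := (V + edge_of * 'I_(m - 2))%type.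

Definition power_edge (e : edge_of) : {set power_vertex} :=
  [set x | match x with inl u => u \in val e | inr p => p.1 == e end].

Lemma power_edges_neq0 : set0 \notin [set power_edge e | e : edge_of].
Proof.
apply/imsetP => -[e _ E0].
have /set0Pn[u ue] : val e != set0.
  by apply: contraNneq (hedges_neq0 G) => <-; apply: valP.
by have := in_set0 (inl u : power_vertex); rewrite E0 inE ue.
Qed.

Definition power : hypergraph power_vertex := Hypergraph power_edges_neq0.

End Power.

(* A (simple, finite) graph is a 2-uniform hypergraph. *)
Definition is_power (m : nat) (V : finType) (H : hypergraph V) : Prop :=
  exists (W : finType) (G : hypergraph W), uniform 2 G /\ hyp_iso H (power G m).

(* The last condition is [#|V| = k (m - 1) - 1] for [k] edges, written without
   truncated subtraction. *)
Definition TC1 (m : nat) (V : finType) (H : hypergraph V) : Prop :=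
  [/\ uniform m H /\ linear_hypergraph H, connected_hypergraph H,
      num_loose_cycles H = 3, is_power m H
    & #|V| + 1 = #|hedges H| * (m - 1)].

Section Pendant.
Variables (V : finType) (H : hypergraph V) (m : nat) (l : V -> nat).

(* [Tagged _ j : pendant] with tag [u] is the [j]-th pendant edge at [u];
   [inr (p, i)] is the [i]-th of the [m - 1] new vertices of [p]. *)
Definition pendant : finType := {u : V & 'I_(l u)}.

Definition pendant_vertex : finType := (V + pendant * 'I_(m - 1))%type.

Definition old_edge (e : {set V}) : {set pendant_vertex} :=
  [set inl u | u in e].

Definition pendant_edge (p : pendant) : {set pendant_vertex} :=
  [set x | match x with inl u => u == tag p | inr q => q.1 == p end].

Lemma pendant_edges_neq0 :
  set0 \notin [set old_edge e | e in hedges H] :|: [set pendant_edge p | p : pendant].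
Proof.
rewrite in_setU negb_or; apply/andP; split; apply/imsetP => -[x xH E0].
  have /set0Pn[u ux] : x != set0.
    by apply: contraNneq (hedges_neq0 H) => <-.
  have := in_set0 (inl u : pendant_vertex).
  by rewrite E0 => /negP; apply; apply: imset_f.
by have := in_set0 (inl (tag x) : pendant_vertex); rewrite E0 inE eqxx.
Qed.

Definition attach_pendants : hypergraph pendant_vertex :=
  Hypergraph pendant_edges_neq0.

End Pendant.

Definition core (i : nat) : 'I_4 := inord i.-1.

(* Vertex [v_i] of the core is [core i]; the edges are [e_1, ..., e_5], with
   [e_3 = v_3 v_1] the edge shared by the two triangles. *)
Definition T1_graph_edges : {set {set 'I_4}} :=
  [set [set core 1; core 2]; [set core 2; core 3]; [set core 3; core 1];
       [set core 3; core 4]; [set core 4; core 1]].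

Lemma T1_graph_edges_neq0 : set0 \notin T1_graph_edges.
Proof.
have ne (i j : 'I_4) : (set0 == [set i; j]) = false.
  by apply/negP => /eqP/setP/(_ i); rewrite !inE eqxx.
by rewrite !inE !ne.
Qed.

Definition T1_graph : hypergraph 'I_4 := Hypergraph T1_graph_edges_neq0.

Definition T1C_pendants (m l1 l2 l3 l4 : nat) (x : power_vertex T1_graph m) : nat :=
  match x with
  | inl i => nth 0 [:: l1; l2; l3; l4] i
  | inr _ => 0
  end.

Definition T1C (m l1 l2 l3 l4 : nat) :=
  attach_pendants (power T1_graph m) m (@T1C_pendants m l1 l2 l3 l4).

(* Imported only here because classical_sets shadows the finite-set notations
   used above. *)
From mathcomp Require Import classical_sets reals complex.

Local Open Scope ring_scope.

Definition adjacency_matrix (R : realType) (m : nat) (V : finType)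
    (H : hypergraph V) : 'M[R]_#|V| :=
  \matrix_(i, j)
    if (i != j) && in_common_edge H (enum_val i) (enum_val j)
    then (m%:R - 1)^-1 else 0.

(* Largest modulus of a complex eigenvalue. *)
Definition spectral_radius (R : realType) (n : nat) (A : 'M[R]_n) : R :=
  sup [set ComplexField.Normc.normc z
        | z in [set z : R[i] | eigenvalue (map_mx (real_complex R) A) z]]%classic.

Definition lambda1 (R : realType) (m : nat) (V : finType) (H : hypergraph V) : R :=
  spectral_radius (adjacency_matrix R m H).

(* Main.v *)
(* A hypergraph in TC_1 is the power of a connected graph with k edges and k - 1
   vertices.  Among all such graphs take one whose power has the largest
   radius, with Perron vector x, and let u be a base vertex where x is maximal.
   If w is at distance two from u, replacing the last edge {v, w} of a path
   u, v, w by {u, w} keeps the graph connected and does not decrease the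
   Rayleigh quotient of x; it strictly increases the radius because x is no
   longer an eigenvector.  So u is adjacent to all other vertices, and two edges
   avoid u.  If these were disjoint, moving an endpoint of one of them to the
   other would again increase the radius.  Hence they share a vertex, and the
   power is T_1C(k - 5, 0, 0, 0).

   For the bound, let A be the 0/1 adjacency matrix, with radius mu.  Every row
   sum of A^2 - (m + 1) A is at most (k - 3)(m - 1), and one of them is smaller,
   so pairing with x gives mu^2 - (m + 1) mu < (k - 3)(m - 1). *)
Require Import Defs.
From mathcomp Require Import all_boot all_order all_algebra.
From mathcomp Require Import ring lra zify boolp reals complex.
Import Order.TTheory GRing.Theory Num.Theory.
Local Open Scope ring_scope.
Set Implicit Arguments.
Unset Strict Implicit.
Unset Printing Implicit Defensive.

(** * Rayleigh quotients and the spectral radius *)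

Section Rayleigh.
Variables (R : realFieldType) (I : finType) (a : I -> I -> R).

Definition quad (y : I -> R) := \sum_i y i * \sum_j a i j * y j.

(** A maximizer of the Rayleigh quotient is a critical point. Perturbing [y] by [t] in the single
    coordinate [i] gives an inequality of the form 2 t c <= t^2 (r - a i i) for every [t], where [c]
    is the defect of the eigenvalue equation at [i]; this forces c = 0. *)
Lemma rayleigh_eigenvector (r : R) (y : I -> R) :
    (forall i j, a i j = a j i) ->
    (forall z, quad z <= r * \sum_i z i ^+ 2) ->
    r * \sum_i y i ^+ 2 <= quad y ->
  forall i, \sum_j a i j * y j = r * y i.
Proof.
move=> a_sym ray ry i; set s := \sum_j _.
pose d j : R := (j == i)%:R.
have dl (F : I -> R) : \sum_j d j * F j = F i.
  rewrite (bigD1 i) //= big1 ?addr0 /d ?eqxx ?mul1r // => j /negbTE ->.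
  by rewrite mul0r.
have dr (F : I -> R) : \sum_j F j * d j = F i.
  by rewrite -[RHS]dl; apply: eq_bigr => j _; rewrite mulrC.
have quadD t : quad (fun j => y j + t * d j) = quad y + t * s *+ 2 + t ^+ 2 * a i i.
  have E j : \sum_l a j l * (y l + t * d l) = \sum_l a j l * y l + t * a j i.
    under eq_bigr do rewrite mulrDr mulrCA.
    by rewrite big_split -mulr_sumr dr.
  rewrite /quad; under eq_bigr do rewrite E mulrDl !mulrDr -!mulrA !(mulrCA _ t).
  rewrite !big_split /= -!mulr_sumr dl.
  have -> : \sum_j y j * a j i = s.
    by apply: eq_bigr => j _; rewrite mulrC a_sym.
  by rewrite dl -/s; ring.
have sqD t : \sum_j (y j + t * d j) ^+ 2 = \sum_j y j ^+ 2 + t * y i *+ 2 + t ^+ 2.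
  under eq_bigr => j _ do rewrite sqrrD exprMn mulrCA.
  rewrite !big_split /= -!mulr_sumr dr -mulr2n; congr (_ + _ + _).
  by under eq_bigr do rewrite expr2; rewrite dl /d eqxx mulr1.
set c := s - r * y i; suff c0 : c = 0 by apply/eqP; rewrite -subr_eq0 -/c c0.
(* [K] is a positive upper bound of [r - a i i], whose own sign is unknown; taking t = c / K below
   yields 2 c^2 / K <= c^2 / K. *)
set K := `|r - a i i| + 1.
have K0 : 0 < K by rewrite ltr_wpDl.
have Kle : r - a i i <= K by rewrite (le_trans (ler_norm _)) // lerDl.
have h2 t : t * c *+ 2 <= t ^+ 2 * (r - a i i).
  have := ray (fun j => y j + t * d j); rewrite quadD sqD /c => h.
  have -> : t * (s - r * y i) *+ 2 = t * s *+ 2 - r * (t * y i *+ 2) by ring.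
  rewrite mulrBr [t ^+ 2 * r]mulrC; move: ry h; rewrite !mulrDr.
  move: (t * s *+ 2) (r * (t * y i *+ 2)) (t ^+ 2 * _) (r * t ^+ 2) (quad y).
  by move: (r * _) => *; lra.
have {}h2 := h2 (c / K).
have h3 : (c / K) ^+ 2 * (r - a i i) <= c / K * c.
  apply: (le_trans (ler_wpM2l (sqr_ge0 _) Kle)).
  by rewrite (_ : _ * K = c / K * c) //; field; rewrite gt_eqF.
have h4 : c ^+ 2 / K <= 0.
  by rewrite expr2 mulrAC; move: (le_trans h2 h3); lra.
apply/eqP; rewrite -sqrf_eq0 eq_le sqr_ge0 andbT.
by rewrite pmulr_lle0 ?invr_gt0 in h4.
Qed.

End Rayleigh.

Section SpectralRadius.
Import ComplexField.
Local Open Scope sesquilinear_scope.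

Lemma normcCE (R : realType) (z : R[i]) : `|z| = (Normc.normc z)%:C%C.
Proof. by case: z. Qed.

Lemma sum_normr_sq (R : realType) n (v : 'rV[R[i]]_n) :
  (v *m v ^t* ) 0 0 = \sum_i `|v 0 i| ^+ 2.
Proof. by rewrite mxE; apply: eq_bigr => i _; rewrite !mxE normCK. Qed.

(** By the spectral theorem the largest eigenvalue [L] bounds the quadratic form. For any complex
    eigenvector, the vector of entrywise moduli has Rayleigh quotient at least the modulus of the
    eigenvalue, because the entries of [A] are nonnegative. Hence no eigenvalue exceeds [L] in
    modulus, and the moduli of an eigenvector for [L] form a nonnegative maximizer, which is an
    eigenvector. *)
Lemma spectral_radius_sym (R : realType) n (A : 'M[R]_n) :
    (0 < n)%N -> A^T = A -> (forall i j, 0 <= A i j) ->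
  let r := spectral_radius A in
  (exists x : 'I_n -> R, [/\ forall i, 0 <= x i, exists i, x i != 0
      & forall i, \sum_j A i j * x j = r * x i])
  /\ forall y : 'I_n -> R, quad A y <= r * \sum_i y i ^+ 2.
Proof.
move=> n0 A_sym A_ge0.
have Aij i j : A i j = A j i by rewrite -{1}A_sym mxE.
set M := map_mx (real_complex R) A.
have Mherm : M \is hermsymmx.
  apply: realsym_hermsym.
    by apply/is_hermitianmxP; rewrite expr0 scale1r map_mx_id // map_trmx A_sym.
  by apply/mxOverP => i j; rewrite mxE; apply/complex_realP; exists (A i j).
set P := spectralmx M; set d := spectral_diag M.
have Munit : P \is unitarymx := spectral_unitarymx M.
have MP : M = invmx P *m diag_mx d *m P.
  exact/orthomx_spectralP/hermitian_normalmx.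
have dreal i : d 0 i = (complex.Re (d 0 i))%:C%C.
  by rewrite RRe_real //; apply: (mxOverP (hermitian_spectral_diag_real Mherm)).
pose D i := complex.Re (d 0 i).
pose i0 := [arg max_(i > Ordinal n0) D i]%O; pose L := D i0.
have DL i : D i <= L by rewrite /L /i0; case: arg_maxP => // j _ /(_ i isT).
have ray (y : 'I_n -> R) : quad A y <= L * \sum_i y i ^+ 2.
  pose yc : 'rV[R[i]]_n := \row_i (y i)%:C%C.
  pose z := yc *m invmx P.
  have ycC : yc ^t* = yc^T.
    by apply/matrixP => i j; rewrite !mxE; apply: conjc_real.
  have zC : z ^t* = P *m yc ^t*.
    rewrite /z invmx_unitary // trmx_mul map_mxM /=; congr (_ *m _).
    by rewrite map_trmx trmxK -map_mx_comp map_mx_id //; apply: conjCK.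
  have E1 : (quad A y)%:C%C = \sum_i d 0 i * `|z 0 i| ^+ 2.
    transitivity ((z *m diag_mx d *m z ^t* ) 0 0).
      rewrite zC ycC /z !mulmxA -(mulmxA yc) -(mulmxA yc) -MP mxE.
      under [RHS]eq_bigr do rewrite mxE mulr_suml.
      rewrite [RHS]exchange_big rmorph_sum; apply: eq_bigr => i _.
      rewrite rmorphM rmorph_sum mulr_sumr; apply: eq_bigr => j _.
      by rewrite !mxE rmorphM mulrA.
    rewrite mxE; apply: eq_bigr => i _; rewrite mul_mx_diag !mxE normCK.
    by rewrite mulrAC mulrC.
  have E2 : (\sum_i y i ^+ 2)%:C%C = \sum_i `|z 0 i| ^+ 2.
    rewrite -sum_normr_sq zC /z mulmxA mulmxKV ?unitarymx_unit // ycC mxE rmorph_sum.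
    by apply: eq_bigr => i _; rewrite !mxE rmorphXn expr2.
  rewrite -lecR rmorphM /= E1 E2 mulr_sumr ler_sum // => i _.
  by rewrite ler_wpM2r ?exprn_ge0 // dreal lecR DL.
have modulus (z : R[i]) (v : 'rV_n) : v *m M = z *: v ->
    let y i := Normc.normc (v 0 i) in Normc.normc z * \sum_i y i ^+ 2 <= quad A y.
  move=> vM /=; rewrite mulr_sumr ler_sum // => j _.
  rewrite expr2 mulrCA ler_wpM2l //; first by rewrite -ler0c -normcCE.
  rewrite -Normc.normcM -lecR -normcCE.
  have -> : z * v 0 j = (z *: v) 0 j by rewrite mxE.
  rewrite -vM mxE rmorph_sum (le_trans (ler_norm_sum _ _ _)) // ler_sum // => i _.
  by rewrite normrM normcCE mxE ger0_norm ?ler0c // rmorphM mulrC Aij.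
have norm_ge0 (z : R[i]) : 0 <= Normc.normc z by rewrite -ler0c -normcCE.
have norm0 (v : 'rV[R[i]]_n) : v != 0 -> exists i, Normc.normc (v 0 i) != 0.
  move=> v0; have [i vi] : exists i, v 0 i != 0.
    apply/existsP; apply: contraR v0; rewrite negb_exists => /forallP v0.
    by apply/eqP/rowP => i; rewrite mxE; have := v0 i; rewrite negbK => /eqP.
  by exists i; apply: contraNneq vi => /Normc.eq0_normc ->.
have sqs_gt0 (y : 'I_n -> R) : (exists i, y i != 0) -> 0 < \sum_i y i ^+ 2.
  move=> [i yi]; rewrite (bigD1 i) //= ltr_pwDl ?exprn_even_gt0 //.
  by apply: sumr_ge0 => j _; apply: sqr_ge0.
have ev_le (z : R[i]) : eigenvalue M z -> Normc.normc z <= L.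
  case/eigenvalueP => v vM /norm0 /sqs_gt0 v0.
  by rewrite -(ler_pM2r v0) (le_trans (modulus _ _ vM)).
(* Since P M = diag(d) P, the rows of [P] are left eigenvectors of [M]. *)
pose v := row i0 P.
have vM : v *m M = L%:C%C *: v.
  rewrite -row_mul MP !mulmxA mulmxV ?unitarymx_unit // mul1mx.
  by apply/rowP => j; rewrite mul_diag_mx !mxE dreal.
have v0 : v != 0.
  apply/eqP => v0; have : row_free P by rewrite row_free_unit unitarymx_unit.
  move=> /row_freeP[Q PQ].
  have : row i0 (P *m Q) = 0 by rewrite row_mul -/v v0 mul0mx.
  by rewrite PQ => /rowP/(_ i0); rewrite !mxE eqxx => /eqP; rewrite oner_eq0.
have Lev : eigenvalue M L%:C%C by apply/eigenvalueP; exists v.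
(* Applying [ev_le] to [L] itself bounds its modulus by [L], so [L] is nonnegative. *)
have normL : Normc.normc L%:C%C = L.
  apply: le_anti; rewrite ev_le //= expr0n addr0.
  by rewrite sqrtr_sqr ler_norm.
have rL : spectral_radius A = L.
  apply: le_anti; apply/andP; split.
    by apply: ge_sup; [exists L, L%:C%C | move=> _ [z /ev_le zL <-]].
  rewrite -[X in X <= _]normL; apply: ub_le_sup; last by exists L%:C%C.
  by exists L => _ [z /ev_le zL <-].
rewrite /= rL; split=> //; exists (fun i => Normc.normc (v 0 i)); split => //.
  exact: norm0.
apply: rayleigh_eigenvector => //.
by have := modulus _ _ vM; rewrite normL.
Qed.

End SpectralRadius.

(** * Perron vectors of hypergraphs *)

Definition adj (R : realType) (V : finType) (H : hypergraph V) (v w : V) : R :=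
  ((v != w) && in_common_edge H v w)%:R.

Lemma in_common_edge_sym (V : finType) (H : hypergraph V) :
  symmetric (in_common_edge H).
Proof. by move=> u v; apply: eq_existsb => e; rewrite [(v \in e) && _]andbC. Qed.

Lemma adj_sym (R : realType) (V : finType) (H : hypergraph V) v w :
  adj R H v w = adj R H w v.
Proof. by rewrite /adj eq_sym in_common_edge_sym. Qed.

(** The factor m - 1 turns the weighted matrix into the 0/1 one, and the indices become vertices
    instead of their ranks. *)
Lemma perron (R : realType) (m : nat) (V : finType) (H : hypergraph V) :
    (2 <= m)%N -> (0 < #|V|)%N ->
  let r := (m%:R - 1) * lambda1 R m H in
  (exists x : V -> R, [/\ forall v, 0 <= x v, exists v, x v != 0
      & forall v, \sum_w adj R H v w * x w = r * x v])
  /\ forall y : V -> R, quad (adj R H) y <= r * \sum_v y v ^+ 2.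
Proof.
move=> m2 V0; set c : R := m%:R - 1.
have c0 : 0 < c by rewrite subr_gt0 ltr1n.
have AE i j : adjacency_matrix R m H i j = c^-1 * adj R H (enum_val i) (enum_val j).
  rewrite mxE /adj (inj_eq enum_val_inj).
  by case: ifP => _; rewrite ?mulr1 ?mulr0.
have sumE (F : V -> R) : \sum_v F v = \sum_(i < #|V|) F (enum_val i).
  apply: reindex; apply: onW_bij; exact: (Bijective (@enum_valK V) (@enum_rankK V)).
have := @spectral_radius_sym R _ (adjacency_matrix R m H) V0.
case.
- by apply/matrixP => i j; rewrite mxE !AE adj_sym.
- by move=> i j; rewrite AE mulr_ge0 ?ler0n // invr_ge0 ltW.
rewrite -/(lambda1 R m H) => -[x [x0 [i xi] xE]] ray; split.
  exists (x \o enum_rank); split => [v||v] /=.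
  - exact: x0.
  - by exists (enum_val i); rewrite /= enum_valK.
  rewrite -mulrA -xE mulr_sumr sumE; apply: eq_bigr => j _.
  by rewrite AE /= enum_valK enum_rankK mulrA mulVKf ?gt_eqF.
move=> y; have := ray (y \o enum_val); rewrite -(ler_pM2l c0) !mulrA.
rewrite sumE /quad sumE mulr_sumr; congr (_ <= _).
apply: eq_bigr => j _; rewrite mulrCA sumE; congr (_ * _); rewrite mulr_sumr.
by apply: eq_bigr => l _; rewrite AE !mulrA mulfV ?gt_eqF // mul1r.
Qed.

Lemma hyp_iso_sym (V W : finType) (H : hypergraph V) (K : hypergraph W) :
  hyp_iso H K -> hyp_iso K H.
Proof.
case=> f [[g fK gK] HK]; exists g; split; first by exists f.
rewrite -HK -imset_comp -[RHS]imset_id; apply: eq_in_imset => e _ /=.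
by rewrite -imset_comp -[RHS]imset_id; apply: eq_in_imset => v _; apply: fK.
Qed.

Lemma hyp_iso_trans (U V W : finType) (H : hypergraph U) (K : hypergraph V)
    (L : hypergraph W) : hyp_iso H K -> hyp_iso K L -> hyp_iso H L.
Proof.
case=> f [fbij HK] [g [gbij KL]]; exists (g \o f); split; first exact: bij_comp.
rewrite -KL -HK -imset_comp; apply: eq_in_imset => e _ /=.
by rewrite imset_comp.
Qed.

Lemma in_common_edge_iso (V W : finType) (H : hypergraph V) (K : hypergraph W)
    (f : V -> W) : injective f -> [set f @: (e : {set V}) | e in hedges H] = hedges K ->
  forall u v, in_common_edge K (f u) (f v) = in_common_edge H u v.
Proof.
move=> f_inj HK u v; apply/existsP/existsP => [[e]|[e]] /and3P[eE ue ve].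
  move: eE ue ve; rewrite -HK => /imsetP[e' e'H ->].
  by rewrite !mem_imset // => ue ve; exists e'; rewrite e'H ue ve.
by exists (f @: e); rewrite -HK !mem_imset ?eE ?ue //; apply: imset_inj.
Qed.

(** The Perron vector of [H], transported along the isomorphism, is a test vector for [K]. *)
Lemma lambda1_iso_le (R : realType) m (V W : finType) (H : hypergraph V)
    (K : hypergraph W) : (2 <= m)%N -> (0 < #|V|)%N ->
  hyp_iso H K -> lambda1 R m H <= lambda1 R m K.
Proof.
move=> m2 V0 [f [fbij HK]]; have [g fK gK] := fbij.
have f_inj := can_inj fK.
have c0 : 0 < m%:R - 1 :> R by rewrite subr_gt0 ltr1n.
have W0 : (0 < #|W|)%N by rewrite -(bij_eq_card fbij).
have [[x [x_ge0 [v0 xv0] xE]] _] := perron R H m2 V0.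
have [_ ray] := perron R K m2 W0.
rewrite -(ler_pM2l c0) -(@ler_pM2r _ (\sum_v x v ^+ 2)); last first.
  rewrite (bigD1 v0) //= ltr_pwDl ?exprn_even_gt0 //.
  by apply: sumr_ge0 => ? _; apply: sqr_ge0.
have sumE (F : W -> R) : \sum_w F w = \sum_v F (f v).
  by apply: reindex; apply: onW_bij.
have := ray (x \o g); rewrite /quad !sumE.
under [X in _ <= _ * X]eq_bigr do rewrite /= fK.
apply: le_trans; rewrite mulr_sumr ler_sum // => v _.
rewrite /= fK expr2 mulrCA -xE sumE.
under [X in _ <= _ * X]eq_bigr do rewrite /= fK /adj (inj_eq f_inj) (in_common_edge_iso f_inj HK).
by [].
Qed.

Lemma lambda1_iso (R : realType) m (V W : finType) (H : hypergraph V)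
    (K : hypergraph W) : (2 <= m)%N -> (0 < #|V|)%N ->
  hyp_iso H K -> lambda1 R m H = lambda1 R m K.
Proof.
move=> m2 V0 HK; apply: le_anti; rewrite lambda1_iso_le //=.
apply: lambda1_iso_le (hyp_iso_sym HK) => //.
by case: HK => f [fbij _]; rewrite -(bij_eq_card fbij).
Qed.

Section LabelledLinear.
Variables (R : realType) (T I : finType) (E : I -> {set T}) (H : hypergraph T).
Hypothesis HE : hedges H = [set E i | i : I].
Hypothesis E_linear : forall i j v w, v != w ->
  v \in E i -> w \in E i -> v \in E j -> w \in E j -> i = j.

(** Linearity leaves at most one nonzero term in the sum. *)
Lemma adj_labelled v w :
  adj R H v w = \sum_(i | v \in E i) (w \in E i :\ v)%:R.
Proof.
rewrite /adj eq_sym; have [->|wv] /= := eqVneq w v.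
  by rewrite big1 // => i _; rewrite !inE eqxx.
have [/existsP[e /and3P[]]|nvw] := boolP (in_common_edge H v w).
  rewrite HE => /imsetP[i _ ->] vi wi.
  rewrite (bigD1 i) //= !inE wv wi big1 ?addr0 // => j /andP[vj ji].
  rewrite !inE wv /=; case wj: (w \in E j) => //; case/eqP: ji.
  by apply: (E_linear wv).
rewrite big1 // => i vi; rewrite !inE wv /=; case wi: (w \in E i) => //.
case/existsP: nvw; exists (E i); rewrite vi wi HE andbT.
by rewrite imset_f.
Qed.

Lemma adj_op (x : T -> R) v : \sum_w adj R H v w * x w =
  \sum_(i | v \in E i) (\sum_(w in E i) x w - x v).
Proof.
under eq_bigr do rewrite adj_labelled mulr_suml.
rewrite exchange_big /=; apply: eq_bigr => i vi.
rewrite [in RHS](bigD1 v) //= addrAC subrr add0r [RHS]big_mkcond /=.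
apply: eq_bigr => w _; rewrite !inE andbC.
by case: ifP => _; rewrite ?mul1r ?mul0r.
Qed.

Lemma adj_quad (x : T -> R) : quad (adj R H) x =
  \sum_i ((\sum_(w in E i) x w) ^+ 2 - \sum_(w in E i) x w ^+ 2).
Proof.
rewrite /quad; under eq_bigr do rewrite adj_op mulr_sumr.
rewrite (exchange_big_dep xpredT) //=; apply: eq_bigr => i _.
under eq_bigr do rewrite mulrBr -expr2.
by rewrite sumrB -mulr_suml -expr2.
Qed.

End LabelledLinear.

(** * Powers of edge-labelled graphs *)

Section LabelledPower.
Variables (m : nat) (W I : finType).

(** Edges carry labels from a fixed type [I], so that the powers of all graphs on [W] with these
    labels share one vertex type and the Perron vector of one graph can be tested on another. *)
Definition lpower_vertex : finType := (W + I * 'I_(m - 2))%type.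

Implicit Types (g : {ffun I -> {set W}}) (i j : I) (u v w : W).

Definition lpower_edge g i : {set lpower_vertex} :=
  [set x | match x with inl u => u \in g i | inr p => p.1 == i end].

Lemma lpower_edges_neq0 g : set0 \notin [set lpower_edge g i | i : I] :\ set0.
Proof. by rewrite !inE eqxx. Qed.

(* Removing [set0] makes the definition total; it is vacuous for the families
   below. *)
Definition lpower g : hypergraph lpower_vertex := Hypergraph (lpower_edges_neq0 g).

Definition lgraph_adj g : rel W := fun u v => [exists i, (u \in g i) && (v \in g i)].

(** Boolean, so that a graph of largest radius can be chosen by [arg max] over a finite type;
    injectivity forbids multiple edges. *)
Definition connected_lgraph g : bool :=
  [&& [forall i, #|g i| == 2%N], injectiveb g
    & [forall u, forall v, connect (lgraph_adj g) u v]].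

Lemma connected_lgraphP g :
  reflect [/\ forall i, #|g i| = 2%N, injective g & forall u v, connect (lgraph_adj g) u v]
    (connected_lgraph g).
Proof.
apply: (iffP and3P) => [[/forallP c /injectiveP gI /forallP con]|[c gI con]].
  by split=> // [i|u v]; [apply/eqP | have /forallP/(_ v) := con u].
split; [by apply/forallP => i; apply/eqP | exact/injectiveP|].
by apply/forallP => u; apply/forallP.
Qed.

Lemma sum_lpower_edge (R : nmodType) g i (x : lpower_vertex -> R) :
  \sum_(t in lpower_edge g i) x t =
  \sum_(w in g i) x (inl w) + \sum_j x (inr (i, j)).
Proof.
rewrite big_sumType /=; congr (_ + _); first by apply: eq_bigl => w; rewrite !inE.
rewrite (eq_bigl (fun p : I * 'I_(m - 2) => (p.1 == i) && true)); last first.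
  by move=> p; rewrite !inE andbT.
rewrite (eq_bigr (fun p => x (inr (p.1, p.2)))); last by case.
by rewrite -(pair_big (pred1 i) xpredT (fun a b => x (inr (a, b)))) big_pred1_eq.
Qed.

Lemma lpowerE g : (forall i, #|g i| = 2%N) ->
  hedges (lpower g) = [set lpower_edge g i | i : I].
Proof.
move=> g2; apply/setP => e; rewrite /= in_setD1; case: eqP => //= ->.
apply/esym/imsetP => -[i _ e0].
have /card_gt0P[w wi] : (0 < #|g i|)%N by rewrite g2.
by have := in_set0 (inl w : lpower_vertex); rewrite e0 inE wi.
Qed.

Section Good.
Variable g : {ffun I -> {set W}}.
Hypothesis g_ok : connected_lgraph g.

Lemma lgraph_card i : #|g i| = 2%N.
Proof. by case/connected_lgraphP: g_ok. Qed.

Lemma lgraph_inj : injective g.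
Proof. by case/connected_lgraphP: g_ok. Qed.

Lemma lgraph_connect u v : connect (lgraph_adj g) u v.
Proof. by case/connected_lgraphP: g_ok. Qed.

Lemma lgraph_edgeE i v w : v != w -> v \in g i -> w \in g i -> g i = [set v; w].
Proof.
move=> vw vi wi; apply/esym/eqP.
by rewrite eqEcard cards2 vw lgraph_card subUset !sub1set vi wi.
Qed.

Lemma lgraph_linear i j v w : v != w ->
  v \in g i -> w \in g i -> v \in g j -> w \in g j -> i = j.
Proof.
by move=> vw vi wi vj wj; apply: lgraph_inj;
  rewrite (lgraph_edgeE vw vi wi) (lgraph_edgeE vw vj wj).
Qed.

Lemma lgraph_edge_ends i v : v \in g i -> exists2 w, w != v & g i = [set v; w].
Proof.
move=> vi; have := lgraph_card i; rewrite (cardsD1 v) vi => -[] /eqP/cards1P[w gw].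
have : w \in g i :\ v by rewrite gw set11.
by rewrite !inE => /andP[wv wi]; exists w; rewrite // -(@lgraph_edgeE i v w) // eq_sym.
Qed.

Lemma lpower_linear i j (s t : lpower_vertex) : s != t ->
  s \in lpower_edge g i -> t \in lpower_edge g i ->
  s \in lpower_edge g j -> t \in lpower_edge g j -> i = j.
Proof.
rewrite !inE; case: s t => [v|p] [w|p'] st.
- by apply: lgraph_linear; apply: contraNneq st => ->.
- by move=> _ /eqP -> _ /eqP.
- by move=> /eqP -> _ /eqP.
- by move=> /eqP -> _ /eqP.
Qed.

Lemma common_edge_lpower i (s t : lpower_vertex) :
  s \in lpower_edge g i -> t \in lpower_edge g i -> in_common_edge (lpower g) s t.
Proof.
by move=> si ti; apply/existsP; exists (lpower_edge g i); rewrite (lpowerE lgraph_card) imset_f ?si.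
Qed.

(** From [s] the property passes to a base vertex of an edge containing it, then along paths of the
    graph, then to the new vertices. *)
Lemma lpower_closed (Z : pred lpower_vertex) :
    (0 < #|I|)%N ->
    (forall i s t, s \in lpower_edge g i -> t \in lpower_edge g i -> Z s -> Z t) ->
  (exists s, Z s) -> forall t, Z t.
Proof.
move=> I0 cl [s Zs].
have Zbase v w : Z (inl v) -> Z (inl w).
  have /connectP[p] := lgraph_connect v w; elim: p v => [|v' p IHp] v /=.
    by move=> _ ->.
  case/andP => /existsP[i /andP[vi v'i]] pth lst Zv; apply: IHp pth lst _.
  by apply: (cl i (inl v)); rewrite ?inE.
have edge_base i : exists w, w \in g i.
  by have /card_gt0P : (0 < #|g i|)%N by rewrite lgraph_card.
have {s Zs} [v Zv] : exists v, Z (inl v).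
  case: s Zs => [v|p] Zs; first by exists v.
  have [w wi] := edge_base p.1; exists w.
  by apply: (cl p.1 (inr p)); rewrite ?inE.
case=> [w|p]; first exact: Zbase Zv.
have [w wi] := edge_base p.1.
by apply: (cl p.1 (inl w)); rewrite ?inE //; apply: Zbase Zv.
Qed.

End Good.

Variable R : realType.

(* The spectral radius of the 0/1 adjacency matrix. *)
Definition mu g : R := (m%:R - 1) * lambda1 R m (lpower g).

Definition edge_sum g (x : lpower_vertex -> R) i := \sum_(t in lpower_edge g i) x t.

Definition lpower_op g (x : lpower_vertex -> R) t :=
  \sum_(i | t \in lpower_edge g i) (edge_sum g x i - x t).

Hypotheses (m_ge2 : (2 <= m)%N) (I_gt0 : (0 < #|I|)%N).

Lemma lpower_vertex_gt0 g : connected_lgraph g -> (0 < #|lpower_vertex|)%N.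
Proof.
move=> g_ok; have /card_gt0P[i _] := I_gt0.
have /card_gt0P[w _] : (0 < #|g i|)%N by rewrite lgraph_card.
by apply/card_gt0P; exists (inl w).
Qed.

(** Where a nonnegative eigenvector vanishes, the eigenvalue equation is a vanishing sum of
    nonnegative terms, so all neighbours vanish too; connectivity would then make the whole vector
    zero. *)
Lemma perron_gt0 g : connected_lgraph g -> exists x : lpower_vertex -> R,
  (forall t, 0 < x t) /\ (forall t, lpower_op g x t = mu g * x t).
Proof.
move=> g_ok; have [[x [x0 [s xs] xE]] _] := perron R (lpower g) m_ge2 (lpower_vertex_gt0 g_ok).
exists x; split=> t; last first.
  by rewrite /mu -xE (adj_op (lpowerE (lgraph_card g_ok)) (lpower_linear g_ok)).
rewrite lt_def x0 andbT; apply: contraNneq xs => xt.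
apply: (lpower_closed g_ok I_gt0 (Z := fun t => x t == 0)) s; last by exists t; apply/eqP.
move=> i {xt}s {}t si ti /eqP xs; have := xE s; rewrite xs mulr0.
move/psumr_eq0P => /(_ (fun r _ => mulr_ge0 (ler0n _ _) (x0 r)))/(_ t isT).
rewrite /adj (common_edge_lpower g_ok si ti) andbT.
by case: eqVneq => [<- _|_ /=]; rewrite ?xs // mul1r => ->.
Qed.

Lemma mu_rayleigh g (y : lpower_vertex -> R) : connected_lgraph g ->
  \sum_i (edge_sum g y i ^+ 2 - \sum_(t in lpower_edge g i) y t ^+ 2)
    <= mu g * \sum_t y t ^+ 2.
Proof.
move=> g_ok; have [_ ray] := perron R (lpower g) m_ge2 (lpower_vertex_gt0 g_ok).
by rewrite -(adj_quad (lpowerE (lgraph_card g_ok)) (lpower_linear g_ok)) ray.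
Qed.

(* Moving the edge [{w, v}] to [{w, u}] changes the Rayleigh quotient at the
   Perron vector [x] by a nonnegative multiple of [x u - x v]; were the radius
   unchanged, [x] would still be an eigenvector, which fails at [u]. *)
Lemma mu_edge_move g g' (x : lpower_vertex -> R) i0 u v w :
    connected_lgraph g -> connected_lgraph g' ->
    (forall t, 0 < x t) -> (forall t, lpower_op g x t = mu g * x t) ->
    (forall i, i != i0 -> g' i = g i) ->
    v != w -> u != w -> u != v -> g i0 = [set w; v] -> g' i0 = [set w; u] ->
  x (inl v) <= x (inl u) -> mu g < mu g'.
Proof.
move=> g_ok g'_ok x0 xE gg' vw uw uv gi0 g'i0 xuv.
rewrite ltNge; apply/negP => mu_le.
pose Y := \sum_j x (inr (i0, j)).
have Y0 : 0 <= Y by apply: sumr_ge0 => j _; apply: ltW.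
have S0 : edge_sum g x i0 = x (inl w) + x (inl v) + Y.
  by rewrite /edge_sum sum_lpower_edge gi0 big_setU1 ?inE 1?eq_sym // big_set1.
have S'0 : edge_sum g' x i0 = x (inl w) + x (inl u) + Y.
  by rewrite /edge_sum sum_lpower_edge g'i0 big_setU1 ?inE 1?eq_sym // big_set1.
have E'E i : i != i0 -> lpower_edge g' i = lpower_edge g i.
  by move=> ii0; apply/setP => -[a|p]; rewrite !inE // gg'.
have S'E i : i != i0 -> edge_sum g' x i = edge_sum g x i.
  by move=> ii0; rewrite /edge_sum E'E.
(* At [u] the operator gains exactly the contribution of the moved edge, which did not contain [u]
   before. *)
have op_u : lpower_op g' x (inl u) = lpower_op g x (inl u) + (x (inl w) + Y).
  rewrite /lpower_op (bigD1 i0) /= ?inE ?g'i0 ?in_set2 ?eqxx ?orbT // S'0 addrC.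
  congr (_ + _); last by rewrite addrAC addrK.
  apply: eq_big => [i|i /andP[_ ii0]]; last by rewrite S'E.
  have [->|ii0] := eqVneq i i0; last by rewrite andbT E'E.
  by rewrite andbF !inE gi0 !inE (negbTE uw) (negbTE uv).
have quad_le : \sum_i (edge_sum g x i ^+ 2 - \sum_(t in lpower_edge g i) x t ^+ 2)
    <= \sum_i (edge_sum g' x i ^+ 2 - \sum_(t in lpower_edge g' i) x t ^+ 2).
  rewrite (bigD1 i0) // [leRHS](bigD1 i0) //=; apply: lerD; last first.
    by apply: ler_sum => i ii0; rewrite E'E // S'E.
  rewrite S0 S'0 !sum_lpower_edge gi0 g'i0 !big_setU1 ?inE 1?eq_sym // ?big_set1.
  rewrite -subr_ge0; set q := \sum_j _.
  have -> : forall a b c : R, (a + b + Y) ^+ 2 - (a ^+ 2 + b ^+ 2 + q)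
      - ((a + c + Y) ^+ 2 - (a ^+ 2 + c ^+ 2 + q)) = 2 * ((b - c) * (a + Y)).
    by move=> a b c; ring.
  by rewrite mulr_ge0 // mulr_ge0 ?subr_ge0 // addr_ge0 // ltW.
have g'_lin := lpower_linear g'_ok; have g_lin := lpower_linear g_ok.
have opE : forall t, \sum_s adj R (lpower g') t s * x s = mu g * x t.
  apply: rayleigh_eigenvector => [s t|z|]; first exact: adj_sym.
    rewrite (adj_quad (lpowerE (lgraph_card g'_ok)) g'_lin).
    apply: le_trans (mu_rayleigh _ g'_ok) _.
    by rewrite ler_wpM2r // sumr_ge0 // => t _; apply: sqr_ge0.
  rewrite (adj_quad (lpowerE (lgraph_card g'_ok)) g'_lin); apply: le_trans quad_le.
  rewrite -(adj_quad (lpowerE (lgraph_card g_ok)) g_lin) /quad mulr_sumr ler_sum // => t _.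
  by rewrite (adj_op (lpowerE (lgraph_card g_ok)) g_lin) [X in _ <= _ * X]xE expr2 mulrCA.
have := opE (inl u); rewrite (adj_op (lpowerE (lgraph_card g'_ok)) g'_lin) -xE [LHS]op_u.
move/eqP; rewrite -subr_eq0 addrAC subrr add0r.
by rewrite gt_eqF // ltr_pwDl.
Qed.

End LabelledPower.

(** * The hypergraph T_1C(l, 0, 0, 0) *)

Lemma card_lpower_edge m (W I : finType) (g : {ffun I -> {set W}}) i :
  (2 <= m)%N -> #|g i| = 2%N -> #|lpower_edge m g i| = m.
Proof.
move=> m2 gi; rewrite -sum1_card sum_lpower_edge !sum1_card gi card_ord.
by rewrite -[X in _ = X](subnKC m2).
Qed.

(* [beta] embeds the base vertices; each remaining vertex lies in at most one
   edge, so the remaining vertices of [eps i] can be matched with the new ones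
   of edge [i] in any order. *)
Lemma lpower_iso m (W I V : finType) (g : {ffun I -> {set W}}) (K : hypergraph V)
    (beta : W -> V) (eps : I -> {set V}) :
    (2 <= m)%N -> (forall i, #|g i| = 2%N) -> injective beta ->
    hedges K = [set eps i | i : I] -> (forall i, #|eps i| = m) ->
    (forall i w, (beta w \in eps i) = (w \in g i)) ->
    (forall i j t, i != j -> t \in eps i -> t \in eps j -> t \in codom beta) ->
    (#|V| <= #|lpower_vertex m W I|)%N ->
  hyp_iso (lpower m g) K.
Proof.
move=> m2 g2 beta_inj KE eps_card beta_eps eps_cap V_card.
pose F i := [set t in eps i | t \notin codom beta].
have F_card i : (m - 2)%N = #|F i|.
  rewrite -(eps_card i) -(cardsID (beta @: g i) (eps i)).
  have -> : eps i :&: beta @: g i = beta @: g i.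
    by apply/setIidPr/subsetP => _ /imsetP[w wi ->]; rewrite beta_eps.
  rewrite card_imset // g2 addKn; apply: eq_card => t; rewrite !inE andbC.
  case ti: (t \in eps i) => //=; congr (~~ _); apply/imsetP/codomP => [[w _ ->]|[w tw]].
    by exists w.
  by exists w => //; rewrite -beta_eps -tw.
pose f (t : lpower_vertex m W I) := match t with
  | inl w => beta w
  | inr p => enum_val (cast_ord (F_card p.1) p.2)
  end.
have fr p : f (inr p) \in F p.1 by apply: enum_valP.
have frN p w : f (inr p) != beta w.
  by have := fr p; rewrite inE => /andP[_]; apply: contraNneq => ->; apply: codom_f.
have f_inj : injective f.
  move=> [v|[i a]] [w|[j b]].
  - by move/beta_inj => ->.
  - by move/esym/eqP; rewrite (negbTE (frN _ _)).
  - by move/eqP; rewrite (negbTE (frN _ _)).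
  move=> fE; have [ij|ij] := eqVneq i j.
    by subst j; move/enum_val_inj/cast_ord_inj: fE => /= ->.
  have := fr (i, a); rewrite inE => /andP[fi /negP[]].
  apply: (eps_cap i j) => //; rewrite fE.
  by have := fr (j, b); rewrite inE => /andP[].
(* The cardinality hypothesis excludes vertices of [K] outside the image of [f]. *)
exists f; split; first exact: inj_card_bij.
rewrite lpowerE // KE -imset_comp; apply: eq_imset => i /=.
apply/eqP; rewrite eqEcard card_imset // card_lpower_edge // eps_card leqnn andbT.
apply/subsetP => _ /imsetP[[w|p] + ->]; rewrite inE; first by rewrite /= beta_eps.
by move/eqP => <-; have := fr p; rewrite inE => /andP[].
Qed.

Lemma coreE i : (0 < i <= 4)%N -> core i = i.-1 :> nat.
Proof. by case: i => // i /= i4; rewrite /core inordK. Qed.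

Lemma core_eq i j : (0 < i <= 4)%N -> (0 < j <= 4)%N -> (core i == core j) = (i == j).
Proof.
by case: i j => [|i] [|j] // i4 j4; rewrite -val_eqE /= !coreE.
Qed.

Section Extremal.
Variables (m l : nat).
Hypothesis m_ge2 : (2 <= m)%N.

Notation T1_pendant := (pendant (@T1C_pendants m l 0 0 0)).

Definition T1C_skeleton_vertex : finType := ('I_4 + T1_pendant)%type.
Definition T1C_skeleton_edge : finType := (edge_of T1_graph + T1_pendant)%type.

(* A graph whose power is [T1C m l 0 0 0]: [inr p] stands for one of the [m - 1]
   new vertices of the pendant edge [p]. *)
Definition T1C_skeleton : {ffun T1C_skeleton_edge -> {set T1C_skeleton_vertex}} :=
  [ffun i : T1C_skeleton_edge => match i return {set T1C_skeleton_vertex} with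
     | inl e => [set inl v | v in val e]
     | inr p => [set inl (core 1); inr p]
     end].

Lemma tag_T1_pendant (p : T1_pendant) : tag p = inl (core 1).
Proof.
case: p => -[v|e] [j j_lt] //=; congr inl; apply/val_inj; rewrite /= coreE //.
by case: v j_lt => -[|[|[|[|]]]] //= v_lt.
Qed.

Lemma card_T1_pendant : #|T1_pendant| = l.
Proof.
rewrite card_tagged sumnE big_map big_enum /= (bigD1 (inl (core 1))) //=.
rewrite card_ord /= coreE //= big1 ?addn0 // => -[v|e] /=; last by rewrite card_ord.
rewrite card_ord; case: v => -[|[|[|[|]]]] //= v_lt /eqP[].
by congr inl; apply/val_inj; rewrite /= coreE.
Qed.

Lemma T1_graph_card (e : edge_of T1_graph) : #|val e| = 2%N.
Proof.
by case: e => e /=; rewrite !inE -!orbA => /or4P[| | |/orP[]] /eqP ->;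
  rewrite cards2 core_eq.
Qed.

Lemma T1C_skeleton_card i : #|T1C_skeleton i| = 2%N.
Proof.
rewrite ffunE; case: i => [e|p]; last by rewrite cards2.
by rewrite card_imset ?T1_graph_card // => v w [].
Qed.

Lemma T1C_skeleton_inj : injective T1C_skeleton.
Proof.
have old (e : edge_of T1_graph) p :
    T1C_skeleton (inl e) != T1C_skeleton (inr p).
  apply/eqP => /setP/(_ (inr p)); rewrite !ffunE !inE eqxx.
  by move/imsetP => -[].
case=> [e|p] [e'|q] /eqP; rewrite ?(negbTE (old _ _)) //.
- rewrite !ffunE => /eqP/imset_inj-/(_ (fun _ _ => @inl_inj _ _ _ _))/val_inj -> //.
- by rewrite eq_sym (negbTE (old _ _)).
- by rewrite !ffunE => /eqP/setP/(_ (inr p)); rewrite !inE eqxx /= => /esym/eqP[->].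
Qed.

Lemma T1C_skeleton_iso : hyp_iso (lpower m T1C_skeleton) (T1C m l 0 0 0).
Proof.
have m1 : (0 < m - 1)%N by rewrite subn_gt0.
(* The new vertex of index 0 in each pendant edge plays the role of its second base vertex. *)
pose beta (w : T1C_skeleton_vertex) : pendant_vertex m (@T1C_pendants m l 0 0 0) :=
  match w with inl v => inl (inl v) | inr p => inr (p, Ordinal m1) end.
pose eps (i : T1C_skeleton_edge) := match i with
  | inl e => old_edge m (@T1C_pendants m l 0 0 0) (power_edge m e)
  | inr p => pendant_edge m p
  end.
have in_old A (t : power_vertex T1_graph m) :
    (inl t \in old_edge m (@T1C_pendants m l 0 0 0) A) = (t \in A).
  by rewrite mem_imset // => ? ? [].
have inr_old A p : (inr p \in old_edge m (@T1C_pendants m l 0 0 0) A) = false.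
  by apply/imsetP => -[].
apply: (@lpower_iso _ _ _ _ _ _ beta eps) => //.
- exact: T1C_skeleton_card.
- by move=> [v|p] [w|q] //= [->].
- apply/setP => e; apply/setUP/imsetP.
    case=> [/imsetP[_ /imsetP[a _ ->] ->]|/imsetP[p _ ->]].
      by exists (inl a).
    by exists (inr p).
  case=> -[a|p] _ ->; [left|right].
    by apply: imset_f; apply: imset_f.
  exact: imset_f.
- case=> [e|p].
    rewrite card_imset; last by move=> ? ? [].
    have -> : power_edge m e = lpower_edge m [ffun e : edge_of T1_graph => val e] e.
      by apply/setP => -[v|q]; rewrite !inE // ffunE.
    by rewrite card_lpower_edge // ffunE T1_graph_card.
  rewrite -sum1_card big_sumType /= (eq_bigl (pred1 (tag p))); last first.
    by move=> v; rewrite !inE.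
  rewrite big_pred1_eq (eq_bigl (fun q : T1_pendant * 'I_(m - 1) => (q.1 == p) && true)).
    rewrite -(pair_big (pred1 p) xpredT (fun _ _ => 1%N)) big_pred1_eq sum1_card card_ord.
    by rewrite subnKC // ltnW.
  by move=> q; rewrite !inE andbT.
- case=> [e|p] [w|q]; rewrite /= ffunE.
  + rewrite in_old inE mem_imset //; by move=> ? ? [].
  + rewrite inr_old; apply/esym/imsetP => -[] //.
  + by rewrite !inE tag_T1_pendant orbF.
  + by rewrite !inE.
- case=> [e|p] [e'|p'] [t|t] ij.
  + rewrite !in_old; case: t => [v|q]; first by move=> _ _; apply/codomP; exists (inl v).
    by rewrite !inE => /eqP -> /eqP ee; rewrite ee eqxx in ij.
  + by rewrite inr_old.
  + move=> _; rewrite inE => /eqP ->; rewrite tag_T1_pendant.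
    by apply/codomP; exists (inl (core 1)).
  + by rewrite inr_old.
  + by rewrite !inE => /eqP -> _; rewrite tag_T1_pendant; apply/codomP; exists (inl (core 1)).
  + by rewrite inr_old.
  + by rewrite !inE => /eqP -> _; rewrite tag_T1_pendant; apply/codomP; exists (inl (core 1)).
  + by rewrite !inE => /eqP -> /eqP ee; rewrite ee eqxx in ij.
- rewrite /pendant_vertex /power_vertex !card_sum !card_prod !card_ord.
  rewrite (_ : #|T1C_skeleton_edge| = #|edge_of T1_graph| + #|T1_pendant|)%N ?card_sum //.
  (* Here [a] counts core edges and [b] pendant edges; the m - 1 new vertices of a pendant edge
     split into one base vertex and m - 2 vertices added by the power. *)
  apply: eq_leq; have arith a b : (4 + a * (m - 2) + b * (m - 1) = 4 + b + (a + b) * (m - 2))%N.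
    by rewrite (_ : m - 1 = (m - 2).+1)%N ?mulnS; lia.
  exact: arith.
Qed.

End Extremal.

(** * Graphs of largest radius *)

Lemma connect_exit (T : finType) (e : rel T) (S : pred T) a b :
  connect e a b -> S a -> ~~ S b -> exists v w, [/\ S v, ~~ S w & e v w].
Proof.
move=> /connectP[p]; elim: p a => [|c p IHp] a /=; first by move=> _ -> ->.
case/andP=> ac pth lst Sa Sb; have [Sc|Sc] := boolP (S c); first exact: IHp pth lst Sc Sb.
by exists a, c.
Qed.

Definition edge_update (W I : finType) (g : {ffun I -> {set W}}) i0 A :
  {ffun I -> {set W}} := [ffun i => if i == i0 then A else g i].

Lemma lgraph_adj_edge (W I : finType) (g : {ffun I -> {set W}}) i v w :
  v \in g i -> w \in g i -> lgraph_adj g v w.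
Proof. by move=> vi wi; apply/existsP; exists i; rewrite vi. Qed.

Lemma lgraph_adj_sym (W I : finType) (g : {ffun I -> {set W}}) :
  symmetric (lgraph_adj g).
Proof. by move=> v w; apply: eq_existsb => i; rewrite andbC. Qed.

(** Any path of [g] through the removed edge can be rerouted along the assumed connection from [w]
    to [v]; the absence of the edge {w, u} in [g] keeps the labelling injective. *)
Lemma edge_update_connected (W I : finType) (g : {ffun I -> {set W}}) i0 u v w :
    connected_lgraph g -> g i0 = [set w; v] -> u != w ->
    (forall i, g i != [set w; u]) ->
    connect (lgraph_adj (edge_update g i0 [set w; u])) w v ->
  connected_lgraph (edge_update g i0 [set w; u]).
Proof.
move=> g_ok gi0 uw new wv; have [g2 g_inj con] := connected_lgraphP _ g_ok.
set g' := edge_update _ _ _ in wv *.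
have g'0 : g' i0 = [set w; u] by rewrite ffunE eqxx.
have g'E i : i != i0 -> g' i = g i by rewrite ffunE => /negbTE ->.
have g'_sym := sym_connect_sym (@lgraph_adj_sym _ _ g').
apply/connected_lgraphP; split.
- move=> i; have [->|ii0] := eqVneq i i0; last by rewrite g'E.
  by rewrite g'0 cards2 eq_sym uw.
- move=> i j; have [->|ii0] := eqVneq i i0; have [->|ji0] := eqVneq j i0 => //.
  + by rewrite g'0 g'E // => /esym/eqP; rewrite (negbTE (new _)).
  + by rewrite g'0 g'E // => /eqP; rewrite (negbTE (new _)).
  + by rewrite !g'E // => /g_inj.
- move=> a b; apply: connect_sub (con a b) => {}a {}b /existsP[i /andP[ai bi]].
  have [ii0|ii0] := eqVneq i i0; last first.
    by apply/connect1/(@lgraph_adj_edge _ _ _ i); rewrite g'E.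
  move: ai bi; rewrite ii0 gi0 !inE => /orP[] /eqP -> /orP[] /eqP -> //.
  by rewrite g'_sym.
Qed.

Section Maximizer.
Variables (R : realType) (m : nat) (W I : finType) (g : {ffun I -> {set W}}).
Hypotheses (m_ge2 : (2 <= m)%N) (g_ok : connected_lgraph g).
Hypothesis g_max : forall g' : {ffun I -> {set W}},
  connected_lgraph g' -> mu m R g' <= mu m R g.
Hypothesis W_I : #|W|.+1 = #|I|.

(** Otherwise [mu_edge_move] would give a connected graph of larger radius. *)
Lemma maximizer_move (x : lpower_vertex m W I -> R) i0 u v w :
    (forall t, 0 < x t) -> (forall t, lpower_op g x t = mu m R g * x t) ->
    v != w -> u != w -> u != v -> g i0 = [set w; v] ->
    (forall i, g i != [set w; u]) ->
    connect (lgraph_adj (edge_update g i0 [set w; u])) w v ->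
  x (inl u) < x (inl v).
Proof.
move=> x0 xE vw uw uv gi0 new con; rewrite ltNge; apply/negP => xvu.
have g'_ok := edge_update_connected g_ok gi0 uw new con.
have I0 : (0 < #|I|)%N by rewrite -W_I.
have := g_max g'_ok; rewrite leNgt => /negP[].
apply: (mu_edge_move m_ge2 I0 g_ok g'_ok x0 xE _ vw uw uv gi0) => //.
  by move=> i /negbTE ii0; rewrite ffunE ii0.
by rewrite ffunE eqxx.
Qed.

Lemma maximizer_hub (x : lpower_vertex m W I -> R) u :
    (forall t, 0 < x t) -> (forall t, lpower_op g x t = mu m R g * x t) ->
    (forall v, x (inl v) <= x (inl u)) ->
  forall w, w != u -> exists i, g i = [set u; w].
Proof.
move=> x0 xE xu w wu.
have [g2 g_inj con] := connected_lgraphP _ g_ok.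
pose S v := (v == u) || lgraph_adj g u v.
have [|Sw] := boolP (S w).
  rewrite /S (negbTE wu) => /existsP[i /andP[ui wi]].
  by exists i; apply: lgraph_edgeE; rewrite 1?eq_sym.
(* A path from [u] to [w] leaves the closed neighbourhood [S] of [u] by an edge {v, z}, with [z] at
   distance two from [u]. *)
have [|v [z [Sv Sz /existsP[i /andP[vi zi]]]]] := connect_exit (con u w) _ Sw.
  by rewrite /S eqxx.
move: Sz; rewrite /S negb_or => /andP[zu uz].
have vu : v != u by apply: contraNneq uz => <-; apply: (lgraph_adj_edge vi zi).
have vz : v != z by apply: contraTneq Sv => ->; rewrite /S negb_or zu.
have : x (inl u) < x (inl v).
  apply: (@maximizer_move x i u v z) => //; rewrite 1?eq_sym //.
  - by apply: lgraph_edgeE => //; rewrite eq_sym.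
  - move=> j; apply: contraNneq uz => gj.
    by apply: (@lgraph_adj_edge _ _ _ j); rewrite gj !inE eqxx ?orbT.
  set g' := edge_update _ _ _.
  move: Sv; rewrite /S (negbTE vu) => /existsP[j /andP[uj vj]].
  have ji : j != i.
    by apply: contraNneq uz => ji; apply: (@lgraph_adj_edge _ _ _ i); rewrite // -ji.
  (* After the move, [z] and [v] are connected through [u], by the new edge and by the untouched
     edge [j]. *)
  apply: (@connect_trans _ _ u); apply: connect1.
    by apply: (@lgraph_adj_edge _ _ _ i); rewrite ffunE eqxx !inE eqxx ?orbT.
  by apply: (@lgraph_adj_edge _ _ _ j); rewrite ffunE (negbTE ji).
by rewrite ltNge xu.
Qed.

(** The edges at [u] correspond to the other vertices, so #|W| - 1 of the #|W| + 1 edges contain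
    [u]. *)
Lemma card_non_hub u : (forall w, w != u -> exists i, g i = [set u; w]) ->
  #|[set i | u \notin g i]| = 2%N.
Proof.
move=> hub; have [g2 g_inj con] := connected_lgraphP _ g_ok.
have E : g @: [set i | u \in g i] = [set [set u; w] | w in [set~ u]].
  apply/setP => A; apply/imsetP/imsetP => [[j]|[w]]; rewrite !inE.
    move=> /(lgraph_edge_ends g_ok)[w wu gi] ->; exists w; rewrite ?inE //.
  by move=> /hub[i gi] ->; exists i; rewrite ?inE gi ?inE ?eqxx.
have := congr1 (fun A : {set {set W}} => #|A|) E.
rewrite card_imset // card_in_imset ?cardsC1; last first.
  move=> v w; rewrite !inE => vu wu /setP/(_ v); rewrite !inE eqxx orbT (negbTE vu).
  by move/esym/eqP.
have := cardsC [set i | u \in g i]; rewrite -W_I.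
have -> : ~: [set i | u \in g i] = [set i | u \notin g i].
  by apply/setP => i; rewrite !inE.
have : (0 < #|W|)%N by apply/card_gt0P; exists u.
lia.
Qed.

Lemma maximizer_shape : exists u a b c i1 i2,
  [/\ uniq [:: u; b; a; c], forall w, w != u -> exists i, g i = [set u; w],
      forall i, u \notin g i -> i = i1 \/ i = i2,
      g i1 = [set b; a] & g i2 = [set a; c]].
Proof.
have [g2 g_inj con] := connected_lgraphP _ g_ok.
have I0 : (0 < #|I|)%N by rewrite -W_I.
have [x [x0 xE]] := perron_gt0 R m_ge2 I0 g_ok.
have [i0 _] : exists i : I, i \in I by apply/card_gt0P.
have [w0 _] : exists w, w \in g i0 by apply/card_gt0P; rewrite g2.
pose u := [arg max_(v > w0) x (inl v)]%O.
have xu v : x (inl v) <= x (inl u) by rewrite /u; case: arg_maxP => // z _; apply.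
have hub := maximizer_hub x0 xE xu.
have /eqP/cards2P[i1 [i2 [i12 /setP iE]]] := card_non_hub hub.
have non_hub i : (u \notin g i) = (i == i1) || (i == i2).
  by have := iE i; rewrite !inE.
(* If the two edges avoiding [u] were disjoint, replacing {d, c} = g j by {d, a} would be an
   admissible move towards a vertex [a] with an entry at least that of [c]. The order of the edges
   matters only for comparing the entries at [a] and [c]. *)
have meet i j a c : i != j -> u \notin g i -> u \notin g j ->
    (forall k, u \notin g k -> k = i \/ k = j) -> a \in g i -> c \in g j ->
    x (inl c) <= x (inl a) -> exists b, b \in g i :&: g j.
  move=> ij ui uj ij_all ai cj xca; apply/set0Pn/negP => /eqP ij0.
  have disj b : b \in g i -> b \in g j -> False.
    by move=> bi bj; have := in_set0 b; rewrite -ij0 inE bi bj.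
  have [d dc gj] := lgraph_edge_ends g_ok cj.
  have dj : d \in g j by rewrite gj !inE eqxx orbT.
  have ad : a != d by apply/eqP => ad; apply: (disj a) => //; rewrite ad.
  have ac : a != c by apply/eqP => ac; apply: (disj a) => //; rewrite ac.
  have un z k : u \notin g k -> z \in g k -> z != u.
    by move=> uk zk; apply: contraNneq uk => <-.
  have [k1 gk1] := hub d (un _ _ uj dj).
  have [k2 gk2] := hub c (un _ _ uj cj).
  have : x (inl a) < x (inl c).
    (* The edge {d, a} is new: it avoids [u], hence would have to be [i] or [j], against
       disjointness. The ends [d] and [c] remain connected through [u]. *)
    apply: (@maximizer_move x j a c d) => //; rewrite 1?eq_sym //; first by rewrite setUC.
      move=> k; apply/eqP => gk; have [] := ij_all k.
      - by rewrite gk !inE negb_or !(eq_sym u) (un _ _ uj dj) (un _ _ ui ai).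
      - by move=> ki; apply: (disj d); rewrite // -ki gk !inE eqxx.
      - by move=> kj; apply: (disj a); rewrite // -kj gk !inE eqxx orbT.
    apply: (@connect_trans _ _ u); apply: connect1.
      apply: (@lgraph_adj_edge _ _ _ k1); rewrite ffunE; case: eqP => k1j;
        do ?[by rewrite gk1 !inE eqxx ?orbT];
        by move: uj; rewrite -k1j gk1 !inE eqxx.
    apply: (@lgraph_adj_edge _ _ _ k2); rewrite ffunE; case: eqP => k2j;
      do ?[by rewrite gk2 !inE eqxx ?orbT];
      by move: uj; rewrite -k2j gk2 !inE eqxx.
  by rewrite ltNge xca.
have u1 : u \notin g i1 by rewrite non_hub eqxx.
have u2 : u \notin g i2 by rewrite non_hub eqxx orbT.
have [a] : exists a, a \in g i1 :&: g i2.
  have [a1 a1i] : exists w, w \in g i1 by apply/card_gt0P; rewrite g2.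
  have [a2 a2i] : exists w, w \in g i2 by apply/card_gt0P; rewrite g2.
  have [xa|xa] := leP (x (inl a2)) (x (inl a1)).
    by apply: (meet i1 i2 a1 a2) => // k; rewrite non_hub => /orP[] /eqP; [left|right].
  rewrite setIC; apply: (meet i2 i1 a2 a1); rewrite // 1?eq_sym ?ltW //.
  by move=> k; rewrite non_hub => /orP[] /eqP; [right|left].
rewrite inE => /andP[a1 a2].
have [b ba g1] := lgraph_edge_ends g_ok a1.
have [c ca gi2] := lgraph_edge_ends g_ok a2.
exists u, a, b, c, i1, i2; split=> //.
- move: u1 u2; rewrite g1 gi2 !inE !negb_or => /andP[ua ub] /andP[_ uc].
  rewrite /= !inE !negb_or ua ub uc ba (eq_sym a) ca /= !andbT.
  by apply: contraNneq i12 => bc; apply/eqP/g_inj; rewrite g1 gi2 bc.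
- by move=> i; rewrite non_hub => /orP[] /eqP; [left|right].
- by rewrite setUC.
Qed.

(** The core vertices v_1, v_2, v_3, v_4 go to [u], [b], [a], [c]. Then e_2 and e_4 are the two
    edges avoiding [u], e_1, e_3 and e_5 join [u] to [b], [a] and [c], and every other vertex is the
    end of a pendant edge at [u]. *)
Lemma maximizer_iso : hyp_iso (lpower m g) (T1C m (#|I| - 5) 0 0 0).
Proof.
have [u [a [b [c [i1 [i2 [un hub non_hub gi1 gi2]]]]]]] := maximizer_shape.
have [g2 g_inj con] := connected_lgraphP _ g_ok.
set l := (#|I| - 5)%N.
apply: hyp_iso_trans (T1C_skeleton_iso l m_ge2); apply: hyp_iso_sym.
pose rest := enum [set w | w \notin [:: u; b; a; c]].
have rest_size : size rest = l.
  rewrite -cardE /l -W_I.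
  have := cardsC [set w in [:: u; b; a; c]].
  rewrite cardsE (card_uniqP un) /= => <-; rewrite subSS addKn.
  by apply: eq_card => w; rewrite !inE.
pose phi (v : T1C_skeleton_vertex m l) := match v with
  | inl i => nth u [:: u; b; a; c] i
  | inr p => nth u rest (tagged p)
  end.
have tag_lt (p : pendant (@T1C_pendants m l 0 0 0)) : (tagged p < size rest)%N.
  rewrite rest_size; have := ltn_ord (tagged p); rewrite [X in (_ < X)%N -> _](_ : _ = l) //.
  by rewrite tag_T1_pendant /= coreE.
have phi_inj : injective phi.
  have phi_ne (i : 'I_4) p : phi (inl i) != phi (inr p).
    have : phi (inr p) \in rest by apply: mem_nth.
    rewrite mem_enum inE; apply: contraNneq => <-.
    by apply: mem_nth; apply: ltn_ord.
  move=> [i|p] [j|q].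
  - move/eqP; rewrite nth_uniq ?un //= => /eqP/val_inj -> //.
  - by move/eqP; rewrite (negbTE (phi_ne _ _)).
  - by move/esym/eqP; rewrite (negbTE (phi_ne _ _)).
  move/eqP; rewrite nth_uniq ?enum_uniq //; move: (tag_T1_pendant p) (tag_T1_pendant q).
  case: p q => [s i] [t j] /= st; subst s; move=> ts; subst t => /= /eqP/val_inj ->.
  by [].
(* The four distinct vertices give #|W| >= 4, so the truncated subtraction in [l] is exact. *)
have W_card : #|W| = (4 + l)%N.
  have := max_card (mem [set w in [:: u; b; a; c]]).
  rewrite cardsE (card_uniqP un) /= /l -W_I => W4; by rewrite subSS subnKC.
have phi_onto w : w \in codom phi.
  have := inj_card_onto phi_inj; apply.
  by rewrite W_card card_sum card_ord card_T1_pendant.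
pose gT := T1C_skeleton m l.
have gT_inl (e : edge_of T1_graph) i j : val e = [set core i; core j] ->
    phi @: gT (inl e) = [set phi (inl (core i)); phi (inl (core j))].
  by move=> eE; rewrite ffunE eE !imsetU !imset_set1.
have phi1 : phi (inl (core 1)) = u by rewrite /= coreE.
have phi2 : phi (inl (core 2)) = b by rewrite /= coreE.
have phi3 : phi (inl (core 3)) = a by rewrite /= coreE.
have phi4 : phi (inl (core 4)) = c by rewrite /= coreE.
have uneq z : z \in [:: b; a; c] -> z != u.
  by move=> zs; apply: contraTneq un => <- /=; rewrite zs.
have to_g j : exists i, g i = phi @: gT j.
  case: j => [e|p]; last first.
    rewrite ffunE imsetU !imset_set1 phi1; apply: hub.
    by rewrite -phi1 (inj_eq phi_inj).
  have := valP e; rewrite /= !inE -!orbA => /or4P[| | |/orP[]] /eqP/gT_inl ->;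
    rewrite ?phi1 ?phi2 ?phi3 ?phi4.
  - by apply: hub; apply: uneq; rewrite !inE eqxx ?orbT.
  - by exists i1.
  - by rewrite setUC; apply: hub; apply: uneq; rewrite !inE eqxx ?orbT.
  - by exists i2.
  - by rewrite setUC; apply: hub; apply: uneq; rewrite !inE eqxx ?orbT.
have ex_edge i j : [set core i; core j] \in T1_graph_edges ->
    exists e, phi @: gT (inl e) = [set phi (inl (core i)); phi (inl (core j))].
  by move=> ij; exists (exist (fun e => e \in hedges T1_graph) _ ij); apply: gT_inl.
have from_g i : exists j, g i = phi @: gT j.
  have [] : [/\ [set core 1; core 2] \in T1_graph_edges,
      [set core 2; core 3] \in T1_graph_edges, [set core 3; core 1] \in T1_graph_edges,
      [set core 3; core 4] \in T1_graph_edges & [set core 4; core 1] \in T1_graph_edges].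
    by rewrite !inE !eqxx ?orbT.
  move=> /ex_edge[e1 e1E] /ex_edge[e2 e2E] /ex_edge[e3 e3E] /ex_edge[e4 e4E].
  move=> /ex_edge[e5 e5E].
  rewrite phi1 phi2 in e1E; rewrite phi2 phi3 in e2E; rewrite phi3 phi1 in e3E.
  rewrite phi3 phi4 in e4E; rewrite phi4 phi1 in e5E.
  have [ui|/non_hub[] ->] := boolP (u \in g i); first 1 last.
  - by exists (inl e2); rewrite e2E.
  - by exists (inl e4); rewrite e4E.
  have [w wu ->] := lgraph_edge_ends g_ok ui.
  have /codomP[[k|p] wE] := phi_onto w; last first.
    by exists (inr p); rewrite ffunE imsetU !imset_set1 phi1 wE.
  move: wE wu; case: k => -[|[|[|[|]]]] //= _ -> wu.
  - by rewrite eqxx in wu.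
  - by exists (inl e1).
  - by exists (inl e3); rewrite setUC.
  - by exists (inl e5); rewrite setUC.
have [sigma sigmaE] := choice to_g; have [tau tauE] := choice from_g.
apply: (@lpower_iso _ _ _ _ gT _ (fun v => inl (phi v)) (fun j => lpower_edge m g (sigma j))) => //.
- exact: T1C_skeleton_card.
- by move=> v w [/phi_inj].
- rewrite lpowerE //; apply/setP => e; apply/imsetP/imsetP => [[i _ ->]|[j _ ->]].
    by exists (tau i) => //; congr lpower_edge; apply: g_inj; rewrite sigmaE.
  by exists (sigma j).
- by move=> j; rewrite card_lpower_edge.
- by move=> j w; rewrite inE sigmaE mem_imset.
- move=> i j [w|p] ij; rewrite !inE.
    by have /codomP[v ->] := phi_onto w; move=> _ _; apply/codomP; exists v.
  move=> /eqP -> /eqP s_ij; case/eqP: ij.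
  by apply: (T1C_skeleton_inj (m:=m) (l:=l)); apply: (imset_inj phi_inj); rewrite -!sigmaE s_ij.
- rewrite !card_sum !card_prod !card_ord.
  apply: leq_add; first by rewrite W_card card_T1_pendant.
  rewrite leq_mul2r; apply/orP; right.
  by apply: (@leq_card _ _ tau) => i j ij; apply: g_inj; rewrite !tauE ij.
Qed.

End Maximizer.

(** * The upper bound *)

Section Bound.
Variables (R : realType) (m : nat) (W I : finType) (g : {ffun I -> {set W}}).
Hypotheses (m_ge2 : (2 <= m)%N) (g_ok : connected_lgraph g).
Hypothesis W_I : #|W|.+1 = #|I|.

Definition degree w := #|[set i | w \in g i]|.

Lemma sum_incident (F : W -> nat) :
  (\sum_i \sum_(v in g i) F v = \sum_v degree v * F v)%N.
Proof.
rewrite (exchange_big_dep xpredT) //=; apply: eq_bigr => v _.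
by rewrite sum_nat_const /degree; congr (_ * _)%N; apply: eq_card => i; rewrite !inE.
Qed.

Lemma sum_degree : (\sum_v degree v = #|I|.*2)%N.
Proof.
rewrite -(eq_bigr _ (fun v _ => muln1 (degree v))) -sum_incident.
rewrite (eq_bigr (fun _ => 2%N)) ?sum_nat_const ?muln2 // => i _.
by rewrite sum1_card lgraph_card.
Qed.

Lemma degree_gt0 v : (0 < degree v)%N.
Proof.
have [i _] : exists i : I, i \in I by apply/card_gt0P; rewrite -W_I.
have [w [wi wv]] : exists w, w \in g i /\ w != v.
  have [/(lgraph_edge_ends g_ok)[w wv ->]|vi] := boolP (v \in g i).
    by exists w; rewrite !inE eqxx orbT.
  have /card_gt0P[w wi] : (0 < #|g i|)%N by rewrite lgraph_card.
  by exists w; split=> //; apply: contraNneq vi => <-.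
have /connectP[[|z p] /=] := lgraph_connect g_ok v w.
  by move=> _ wv'; rewrite wv' eqxx in wv.
case/andP => /existsP[j /andP[vj _]] _ _.
by apply/card_gt0P; exists j; rewrite inE.
Qed.

(** Edge [i] is counted twice and every other edge at most once, since it shares at most one vertex
    with [i]. *)
Lemma edge_degree_le i : (\sum_(v in g i) degree v <= #|I|.+1)%N.
Proof.
rewrite (eq_bigr (fun v => \sum_(j | v \in g j) 1)%N); last first.
  by move=> v _; rewrite sum1_card; apply: eq_card => j; rewrite !inE.
rewrite (exchange_big_dep xpredT) //= (bigD1 i) //=.
have -> : (\sum_(v in g i | v \in g i) 1 = 2)%N.
  by rewrite -(lgraph_card g_ok i) -sum1_card; apply: eq_bigl => v; rewrite andbb.
rewrite -[#|I|.+1]/(1 + #|I|)%N (cardD1 i) inE addnA leq_add2l -sum1_card.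
rewrite [leqRHS](eq_bigl (fun j => j != i)); last by move=> j; rewrite !inE andbT.
apply: leq_sum => j ji; rewrite sum1_card; apply/card_le1_eqP => v w.
rewrite !unfold_in /= => /andP[vi vj] /andP[wi wj]; apply/eqP/negPn/negP => vw.
by case/eqP: ji; apply: (lgraph_linear g_ok vw).
Qed.

(** The vertex [w] itself contributes the square of its degree. For its neighbours, one is
    subtracted from each degree before the sum is extended to all vertices other than [w]; this is
    harmless because all degrees are positive, and it makes use of the degree sum. *)
Lemma neighbour_degree_le w :
  (\sum_(i | w \in g i) \sum_(v in g i) degree v <= #|I| + 2 + degree w ^ 2)%N.
Proof.
pose F v := (degree v).-1.
have FE v : degree v = (F v).+1 by rewrite /F prednK ?degree_gt0.
have sumW : (\sum_(v : W) 1 = #|W|)%N by rewrite sum1_card.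
(* The right-hand side is 2 #|I| - #|W| + 1. *)
have F_sum : (\sum_(v | v != w) F v + degree w = #|I| + 2)%N.
  have := sum_degree; rewrite (eq_bigr _ (fun v _ => FE v)).
  rewrite (eq_bigr (fun v => 1 + F v)%N) // big_split /= {1}sumW (bigD1 w) //=.
  rewrite FE; move: (F w) (\sum_(v | v != w) F v)%N W_I.
  by move=> a b <-; rewrite doubleS; move: #|_| => n; lia.
have -> : (\sum_(i | w \in g i) \sum_(v in g i) degree v =
    degree w ^ 2 + (degree w + \sum_(i | w \in g i) \sum_(v in g i | v != w) F v))%N.
  rewrite (eq_bigr (fun i => degree w + (1 + \sum_(v in g i | v != w) F v))%N); last first.
    move=> i wi; rewrite (bigD1 w) //=; congr (_ + _)%N.
    rewrite (eq_bigr (fun v => 1 + F v)%N) // big_split /=; congr (_ + _)%N.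
    have [v vw gi] := lgraph_edge_ends g_ok wi.
    rewrite (eq_bigl (pred1 v)) ?big_pred1_eq // => z; rewrite gi !inE.
    by case: (eqVneq z w) => [->|_] /=; rewrite ?andbT // eq_sym (negbTE vw).
  rewrite !big_split /= !sum_nat_const muln1.
  by rewrite (_ : #|[pred i | w \in g i]| = degree w) ?mulnn //; apply: eq_card => i; rewrite !inE.
rewrite addnC leq_add2r -F_sum addnC leq_add2r.
rewrite (exchange_big_dep (fun v => v != w)) /=; last by move=> i v _ /andP[].
apply: leq_sum => v vw; rewrite sum_nat_const -[leqRHS]mul1n leq_mul2r; apply/orP; right.
apply/card_le1_eqP => i j; rewrite !unfold_in /= => /andP[wi /andP[vi _]] /andP[wj /andP[vj _]].
exact: (lgraph_linear g_ok vw).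
Qed.

Lemma degree_ge2 : exists w, (2 <= degree w)%N.
Proof.
apply/existsP; apply: contraT; rewrite negb_exists => /forallP deg1.
have : (\sum_v degree v <= \sum_(v : W) 1)%N.
  by apply: leq_sum => v _; have := deg1 v; rewrite -ltnNge ltnS.
by rewrite sum_degree sum1_card -W_I; move: #|_| => n; lia.
Qed.

Lemma lpower_op_sym (x y : lpower_vertex m W I -> R) :
  \sum_t x t * lpower_op g y t = \sum_t lpower_op g x t * y t.
Proof.
have opE z t : lpower_op g z t = \sum_s adj R (lpower m g) t s * z s.
  by rewrite (adj_op (lpowerE m (lgraph_card g_ok)) (lpower_linear g_ok)).
under eq_bigr do rewrite opE mulr_sumr.
under [RHS]eq_bigr do rewrite opE mulr_suml.
rewrite exchange_big /=; apply: eq_bigr => s _; apply: eq_bigr => t _.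
by rewrite adj_sym mulrCA mulrA.
Qed.

(** The row sums of the 0/1 adjacency matrix A, divided by m - 1. Row sums of A^2 - (m + 1) A are
    thus m - 1 times the values of A - (m + 1) on this function. *)
Definition lpower_degree (t : lpower_vertex m W I) : R :=
  match t with inl w => (degree w)%:R | inr _ => 1 end.

Lemma lpower_op1 t : lpower_op g (fun=> 1) t = (m%:R - 1) * lpower_degree t.
Proof.
have sum1 i : edge_sum g (fun _ : lpower_vertex m W I => 1 : R) i = m%:R.
  rewrite /edge_sum sum_lpower_edge !sumr_const lgraph_card // card_ord.
   by rewrite natrB //; ring.
rewrite /lpower_op; under eq_bigr do rewrite sum1.
case: t => [w|p].
  rewrite (eq_bigl [in [set i | w \in g i]]); last by move=> i; rewrite !inE.
  by rewrite sumr_const -[LHS]mulr_natr.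
rewrite (eq_bigl (pred1 p.1)); last by move=> i; rewrite !inE eq_sym.
by rewrite big_pred1_eq mulr1.
Qed.

Lemma edge_sum_deg i :
  edge_sum g lpower_degree i = (\sum_(v in g i) degree v)%:R + (m%:R - 2).
Proof.
rewrite /edge_sum sum_lpower_edge /= natr_sum; congr (_ + _).
by rewrite sumr_const card_ord natrB.
Qed.

(** With d the degree of [w], (m - 2 - d) d - (m + 1) d = - (d^2 + 3 d): the parameter [m] cancels,
    and a statement about the graph alone is left. *)
Lemma lpower_op_deg_base w :
  lpower_op g lpower_degree (inl w) - (m%:R + 1) * lpower_degree (inl w) =
  (\sum_(i | w \in g i) \sum_(v in g i) degree v)%:R - (degree w ^ 2 + 3 * degree w)%:R.
Proof.
have -> : lpower_op g lpower_degree (inl w) = (\sum_(i | w \in g i) \sum_(v in g i) degree v)%:R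
    + (m%:R - 2 - (degree w)%:R) * (degree w)%:R.
  rewrite /lpower_op natr_sum (eq_bigl [pred i | w \in g i]); last by move=> i; rewrite !inE.
  under eq_bigr do rewrite edge_sum_deg -addrA.
  rewrite big_split /= sumr_const -[X in _ + X]mulr_natr; congr (_ + _ * _%:R).
  by apply: eq_card => i; rewrite !inE.
by rewrite /= natrD natrM natrX; ring.
Qed.

(** By [neighbour_degree_le] the left-hand side is at most #|I| + 2 - 3 d, where d >= 2 is the
    degree. *)
Lemma lpower_op_deg_lt w : (2 <= degree w)%N ->
  lpower_op g lpower_degree (inl w) - (m%:R + 1) * lpower_degree (inl w) < #|I|%:R - 3.
Proof.
move=> d2; rewrite lpower_op_deg_base ltrBlDr addrAC ltrBrDr -!natrD ltr_nat.
have := neighbour_degree_le w; move: (degree w ^ 2)%N (\sum_(i | _) _)%N #|I| => *; lia.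
Qed.

(** New vertices and base vertices of degree one lie in a single edge, and [edge_degree_le] gives
    #|I| + 1 - 4 for both; larger degrees fall under [lpower_op_deg_lt]. *)
Lemma lpower_op_deg_le t :
  lpower_op g lpower_degree t - (m%:R + 1) * lpower_degree t <= #|I|%:R - 3.
Proof.
case: t => [w|p]; last first.
  rewrite /lpower_op (eq_bigl (pred1 p.1)); last by move=> i; rewrite !inE eq_sym.
  rewrite big_pred1_eq edge_sum_deg /= mulr1.
  have : (\sum_(v in g p.1) degree v)%:R <= #|I|.+1%:R :> R.
    by rewrite ler_nat edge_degree_le.
  by rewrite -natr1; lra.
have [/lpower_op_deg_lt/ltW //|] := leqP 2 (degree w).
rewrite ltnS leq_eqVlt ltnNge degree_gt0 orbF => /eqP d1.
rewrite lpower_op_deg_base d1 lerBlDr addrAC lerBrDr -!natrD ler_nat.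
have : (\sum_(i | w \in g i) \sum_(v in g i) degree v <= \sum_(i | w \in g i) #|I|.+1)%N.
  by apply: leq_sum => i _; apply: edge_degree_le.
rewrite sum_nat_const (@eq_card _ _ [set i | w \in g i]); last by move=> i; rewrite !inE.
by rewrite -/(degree w) d1; move: (\sum_(i | _) _)%N #|I| => *; lia.
Qed.

Lemma mu_quadratic_lt :
  mu m R g ^+ 2 - (m%:R + 1) * mu m R g < (#|I|%:R - 3) * (m%:R - 1).
Proof.
have I0 : (0 < #|I|)%N by rewrite -W_I.
have [x [x0 xE]] := perron_gt0 R m_ge2 I0 g_ok.
set r := mu m R g in xE *; set c : R := m%:R - 1.
have c0 : 0 < c by rewrite subr_gt0 ltr1n.
have [w w2] := degree_ge2.
pose s := \sum_t x t.
have s0 : 0 < s.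
  by rewrite /s (bigD1 (inl w)) //= ltr_pwDl // sumr_ge0 // => t _; apply: ltW.
have op_x (y : lpower_vertex m W I -> R) :
    \sum_t x t * lpower_op g y t = r * \sum_t x t * y t.
  by rewrite lpower_op_sym mulr_sumr; apply: eq_bigr => t _; rewrite xE mulrA.
(* Pairing [x] with the constant function 1 evaluates the pairing with the degrees; [op_x] applied
   to the degrees then produces r^2. *)
have deg_s : c * \sum_t x t * lpower_degree t = r * s.
  have := op_x (fun=> 1); under eq_bigr do rewrite lpower_op1 mulrCA.
  by rewrite -mulr_sumr => ->; congr (_ * _); apply: eq_bigr => t _; rewrite mulr1.
(* Strictness comes from the vertex [w] of degree at least two, where [x] is positive. *)
have : \sum_t x t * (lpower_op g lpower_degree t - (m%:R + 1) * lpower_degree t) < (#|I|%:R - 3) * s.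
  rewrite mulrC mulr_suml (bigD1 (inl w)) // [ltRHS](bigD1 (inl w)) //= ltr_leD //.
    by rewrite ltr_pM2l // lpower_op_deg_lt.
  by apply: ler_sum => t _; rewrite ler_pM2l // lpower_op_deg_le.
under eq_bigr do rewrite mulrBr mulrCA.
rewrite sumrB -mulr_sumr op_x -(ltr_pM2l c0) mulrBr !(mulrCA c) deg_s.
by move=> h; rewrite -(ltr_pM2r s0); move: h; congr (_ < _); rewrite /c; ring.
Qed.

(** Completing the square in [mu_quadratic_lt] bounds (2 mu - (m + 1))^2 by the radicand, which is
    therefore positive. *)
Lemma lambda1_lt :
  lambda1 R m (lpower m g) <
  (m%:R + 1 + Num.sqrt ((m%:R + 1) ^+ 2 + 4 * (#|I|%:R - 3) * (m%:R - 1)))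
    / (2 * m%:R - 2).
Proof.
have c0 : 0 < m%:R - 1 :> R by rewrite subr_gt0 ltr1n.
have c20 : 0 < 2 * m%:R - 2 :> R by move: c0; lra.
rewrite ltr_pdivlMr //.
have -> : lambda1 R m (lpower m g) * (2 * m%:R - 2) = 2 * mu m R g.
  by rewrite /mu; ring.
rewrite -ltrBlDl; have := mu_quadratic_lt; set b := m%:R + 1; set r := mu m R g => h.
apply: le_lt_trans (ler_norm _) _; rewrite -sqrtr_sqr.
have lt : (2 * r - b) ^+ 2 < b ^+ 2 + 4 * (#|I|%:R - 3) * (m%:R - 1).
  by rewrite -mulrA; move: h; set d := (_ * (m%:R - 1)); clearbody d; nra.
by rewrite ltr_sqrt // (le_lt_trans (sqr_ge0 _) lt).
Qed.

End Bound.

(** * From hypergraphs in [TC1] to connected labelled graphs, and the theorem *)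

Lemma connected_iso (V W : finType) (H : hypergraph V) (K : hypergraph W) :
  hyp_iso H K -> connected_hypergraph H -> connected_hypergraph K.
Proof.
case=> f [[f' fK f'K] HK] con u v; rewrite -(f'K u) -(f'K v).
have /connectP[p] := con (f' u) (f' v).
elim: p (f' u) => [|c p IHp] a /=; first by move=> _ ->.
case/andP=> ac pth lst; apply: connect_trans (IHp _ pth lst).
by apply: connect1; rewrite (in_common_edge_iso (can_inj fK) HK).
Qed.

Lemma lpower_connected m (W I : finType) (g : {ffun I -> {set W}}) :
    (forall i, #|g i| = 2%N) -> connected_hypergraph (lpower m g) ->
  forall u v, connect (lgraph_adj g) u v.
Proof.
move=> g2 con u v.
(* Reachability in the graph is extended to new vertices through the ends of their edge, so that no
   edge of the power leaves [S]. *)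
pose S (t : lpower_vertex m W I) := match t with
  | inl w => connect (lgraph_adj g) u w
  | inr p => [exists w in g p.1, connect (lgraph_adj g) u w]
  end.
apply: contraT => uv.
have [s [t [Ss St]]] := connect_exit (S := S) (con (inl u) (inl v)) (connect0 _ _) uv.
case/existsP => e /and3P[]; rewrite lpowerE // => /imsetP[i _ ->] si ti.
have [w wi uw] : exists2 w, w \in g i & connect (lgraph_adj g) u w.
  case: s si Ss => [w|p]; rewrite inE; first by exists w.
  by rewrite /= => /eqP -> /exists_inP[w]; exists w.
case/negP: St; case: t ti => [z|p]; rewrite inE => ti.
  by apply: connect_trans uw (connect1 _); apply: lgraph_adj_edge wi ti.
by apply/exists_inP; exists w; rewrite // (eqP ti).
Qed.

Lemma lpower_edge_inj m (W I : finType) (g : {ffun I -> {set W}}) :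
  injective g -> injective (lpower_edge m g).
Proof.
move=> g_inj i j /setP ij; apply/g_inj/setP => w.
by have := ij (inl w); rewrite !inE.
Qed.

(** The Type I count reads #|W| + #|I| (m - 2) + 1 = #|I| (m - 1), hence #|W| + 1 = #|I|. *)
Lemma TC1_skeleton m (V : finType) (H : hypergraph V) : (2 <= m)%N -> TC1 m H ->
  exists (W I : finType) (g : {ffun I -> {set W}}),
    [/\ connected_lgraph g, #|W|.+1 = #|I|, #|I| = #|hedges H| & hyp_iso H (lpower m g)].
Proof.
move=> m2 [_ H_con _ [W [G [G2 H_iso]]] H_card].
pose g := [ffun e : edge_of G => val e].
have g2 e : #|g e| = 2%N by rewrite ffunE; apply/G2/valP.
have g_inj : injective g by move=> d e; rewrite !ffunE => /val_inj.
have HgE : hyp_iso H (lpower m g).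
  apply: hyp_iso_trans H_iso _; exists id; split; first by exists id.
  rewrite (eq_imset _ (@imset_id _)) imset_id lpowerE //=.
  by apply: eq_imset => e; apply/setP => -[w|p]; rewrite !inE // ffunE.
have I_card : #|edge_of G| = #|hedges H|.
  rewrite -(card_imset xpredT (lpower_edge_inj (m := m) g_inj)).
  have [f [f_bij HK]] := HgE; rewrite -[RHS](card_imset _ (imset_inj (bij_inj f_bij))) HK.
  by rewrite lpowerE //; congr #|mem _|; apply: eq_imset.
exists W, (edge_of G), g; split=> //.
  apply/connected_lgraphP; split=> //.
  exact: lpower_connected g2 (connected_iso HgE H_con).
move: H_card; have [f [f_bij _]] := HgE.
rewrite (bij_eq_card f_bij) -I_card card_sum card_prod card_ord.
move: #|W| #|edge_of G| => a b; rewrite (_ : m - 1 = (m - 2).+1)%N ?mulnS; lia.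
Qed.

Theorem theorem5p1p1 (R : realType) (m k : nat) (V : finType) (H : hypergraph V)
    (m_ge2 : (2 <= m)%N) (H_TC1 : TC1 m H) (H_edges : #|hedges H| = k) :
  (lambda1 R m H <= lambda1 R m (T1C m (k - 5) 0 0 0)
   /\ (lambda1 R m H = lambda1 R m (T1C m (k - 5) 0 0 0) ->
       hyp_iso H (T1C m (k - 5) 0 0 0)))
  /\ lambda1 R m (T1C m (k - 5) 0 0 0)
     < (m%:R + 1 + Num.sqrt ((m%:R + 1) ^+ 2 + 4 * (k%:R - 3) * (m%:R - 1)))
       / (2 * m%:R - 2).
Proof.
have [W [I [g [g_ok W_I I_card H_iso]]]] := TC1_skeleton m_ge2 H_TC1.
have I0 : (0 < #|I|)%N by rewrite -W_I.
have c0 : 0 < m%:R - 1 :> R by rewrite subr_gt0 ltr1n.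
rewrite -H_edges -I_card.
have L0 := lpower_vertex_gt0 m I0 g_ok.
have V0 : (0 < #|V|)%N by case: H_iso => f [f_bij _]; rewrite (bij_eq_card f_bij).
have lambda_H : lambda1 R m H = lambda1 R m (lpower m g) := lambda1_iso R m_ge2 V0 H_iso.
have mu_le (g1 g2 : {ffun I -> {set W}}) : (mu m R g1 <= mu m R g2) =
    (lambda1 R m (lpower m g1) <= lambda1 R m (lpower m g2)).
  by rewrite /mu ler_pM2l.
pose gm := [arg max_(g' > g | connected_lgraph g') mu m R g']%O.
have [gm_ok gm_max] : connected_lgraph gm /\
    forall g' : {ffun I -> {set W}}, connected_lgraph g' -> mu m R g' <= mu m R gm.
  by rewrite /gm; case: arg_maxP.
have lambda_T := lambda1_iso R m_ge2 L0 (maximizer_iso m_ge2 gm_ok gm_max W_I).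
rewrite -lambda_T lambda_H; split; last exact: lambda1_lt.
split=> [|lambda_eq]; first by rewrite -mu_le gm_max.
(* In the equality case [g] is itself a maximizer, so its power has the extremal shape. *)
have g_max (g' : {ffun I -> {set W}}) : connected_lgraph g' -> mu m R g' <= mu m R g.
  by move=> g'_ok; rewrite mu_le lambda_eq -mu_le; apply: gm_max.
exact: hyp_iso_trans H_iso (maximizer_iso m_ge2 g_ok g_max W_I).
Qed.
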